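(* ($\mathcal{Z}$-equations) Let $(n,k,m)$ be a triplet of nonnegative integers with $k+m<n$. Let $\mathcal{Z}$ be a real $n\times(k+m)$ matrix of rank $k+m$, and let $W=\mathcal{Z}^{T}$ denote the $(k+m)$-plane in $\mathbb{R}^n$ spanned by the columns of $\mathcal{Z}$. Let $C\in\mathrm{Gr}_{k,n}$ and let $Y\in\mathrm{Gr}_{k,k+m}$ be the point represented by $C\mathcal{Z}$. Then for every $A\in\binom{[n]}{k+m+1}$ and every $B\in\binom{[n]}{m-1}$, $$\sum_{i\in A}(-1)^{\#i}\,p_{A\setminus i}(W)\,\langle Y,B,i\rangle=0,$$ where $\#i$ is the position of $i$ in the list $A$.
   Context: $[n]=\{1,\dots,n\}$ and $\binom{[n]}{p}$ is the set of strictly increasing lists of $p$ elements of $[n]$ (empty if $p<0$). $\mathrm{Gr}_{k,n}$ is the real Grassmannian of $k$-planes in $\mathbb{R}^n$; a point is represented by a $k\times n$ matrix whose rows span it. $p_{A\setminus i}(W)$ is the maximal minor of the $(k+m)\times n$ matrix $\mathcal{Z}^T$ on the columns indexed by $A\setminus\{i\}$ in increasing order. It is understood that $C\mathcal{Z}$ has rank $k$, so that $Y$ is defined. If $Y$ is represented by a $k\times(k+m)$ matrix with rows $Y_1,\dots,Y_k$ and $\mathcal{Z}_1,\dots,\mathcal{Z}_n\in\mathbb{R}^{k+m}$ are the rows of $\mathcal{Z}$, then $\langle Y,i_1,\dots,i_m\rangle:=\det(Y_1,\dots,Y_k,\mathcal{Z}_{i_1},\dots,\mathcal{Z}_{i_m})$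 (defined up to a common nonzero factor). *)

(* Defs.v *)
From HB Require Import structures.
From mathcomp Require Import all_boot all_order all_algebra.
From mathcomp Require Import reals.

Set Implicit Arguments.
Unset Strict Implicit.
Unset Printing Implicit Defensive.

Import Order.TTheory GRing.Theory Num.Theory.
Local Open Scope ring_scope.

(* The set [n] = {1, ..., n} is encoded as 'I_n = {0, ..., n-1}; only the order
   of the indices matters.  The length p is an integer, so that there are no
   such lists when p < 0. *)
Definition increasing_lists (n : nat) (p : int) : pred (seq 'I_n) :=
  [pred s | ((size s)%:Z == p) && sorted (fun i j : 'I_n => (i < j)%N) s].

Arguments increasing_lists : clear implicits.

Definition Gr (R : realType) (k n : nat) :=
  {V : {vspace 'rV[R]_n} | \dim V == k}.

Definition represents (R : realType) (k n : nat) (M : 'M[R]_(k, n))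
    (V : Gr R k n) : Prop :=
  val V = <<[seq row i M | i : 'I_k]>>%VS.

(* Determinant of the columns of M listed in s; meaningful for size s = d. *)
Definition maximal_minor (R : realType) (d n : nat) (M : 'M[R]_(d, n))
    (s : seq 'I_n) : R :=
  \det (\matrix_(a < d, b < d) nth 0 [seq M a i | i <- s] b).

(* <Y, i_1, ..., i_m> = det (Y_1, ..., Y_k, Z_(i_1), ..., Z_(i_m)), with
   s = [:: i_1; ...; i_m]; meaningful for size s = m. *)
Definition twistor (R : realType) (k m n : nat) (Y : 'M[R]_(k, k + m))
    (Z : 'M[R]_(n, k + m)) (s : seq 'I_n) : R :=
  \det (col_mx Y (\matrix_(j < m) nth 0 [seq row i Z | i <- s] j)).

(* Main.v *)
(* The rows of a (d+1) x d matrix satisfy the Cramer relation, whose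
   coefficients are the signed maximal minors; the twistor coordinate is linear
   in its last entry, so it may be applied to this relation. *)

Require Import Defs.
From HB Require Import structures.
From mathcomp Require Import all_boot all_order all_algebra.
From mathcomp Require Import reals.

Set Implicit Arguments.
Unset Strict Implicit.
Unset Printing Implicit Defensive.

Import Order.TTheory GRing.Theory Num.Theory.
Local Open Scope ring_scope.

(** Prepending column [c] to [M] gives a square matrix with two equal columns; the sum is the
    expansion of its zero determinant along the new column. *)
Lemma cramer_relation (R : comNzRingType) (d : nat) (M : 'M[R]_(d.+1, d)) (c : 'I_d) :
  \sum_(j < d.+1) (-1) ^+ j * \det (row' j M) * M j c = 0.
Proof.
pose N := row_mx (col c M) M : 'M_(1 + d).
have N0 : \det N = 0.
  rewrite -det_tr; apply: (@determinant_alternate _ _ _ (lshift d 0) (rshift 1 c)).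
    by rewrite eq_lrshift.
  by move=> j; rewrite mxE [RHS]mxE row_mxEl row_mxEr mxE.
rewrite -[RHS]N0 (expand_det_col _ (lshift d 0)).
apply: eq_bigr => j _; rewrite row_mxEl mxE mulrC /cofactor addn0.
congr (_ * (_ * \det _)); apply/matrixP => a b; rewrite !mxE.
(* Column 0 is the deleted one, so surviving indices are positive and lie in the block [M]; the
   first case is absurd. *)
case: splitP => [l|l]; rewrite /= /bump leq0n; first by case: l => -[].
by case=> eq_bl; congr (M _ _); apply: val_inj.
Qed.

(** Without repetitions the filter deletes position [j] only, which [bump j] skips. This matches the
    minor on [A] without [i] with [row' j M]. *)
Lemma nth_filter_neq (T : eqType) (x0 : T) (s : seq T) (j b : nat) :
  uniq s -> (j < size s)%N ->
  nth x0 [seq x <- s | x != nth x0 s j] b = nth x0 s (bump j b).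
Proof.
move=> s_uniq lt_js; rewrite -rem_filter // remE index_uniq // nth_cat size_take lt_js.
rewrite /bump; case: ltnP => [lt_bj|le_jb]; first by rewrite nth_take.
by rewrite nth_drop addSn subnKC.
Qed.

Lemma twistor_rcons_linear (R : realType) (k m n : nat) (Y : 'M[R]_(k, k + m.+1))
    (Z : 'M[R]_(n, k + m.+1)) (B : seq 'I_n) :
  size B = m ->
  exists w : 'I_(k + m.+1) -> R,
    forall i, twistor Y Z (rcons B i) = \sum_c Z i c * w c.
Proof.
move=> sB.
pose P u := col_mx Y (\matrix_(j < m.+1) nth 0 (rcons [seq row i Z | i <- B] u) j).
(* The weights are the cofactors of the last row. They do not depend on that row, so [0] is an
   arbitrary filler. *)
exists (cofactor (P 0) (rshift k ord_max)) => i.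
have -> : twistor Y Z (rcons B i) = \det (P (row i Z)) by rewrite /twistor map_rcons.
rewrite (expand_det_row _ (rshift k ord_max)); apply: eq_bigr => c _; congr (_ * _).
  by rewrite col_mxEd mxE nth_rcons size_map sB ltnn eqxx mxE.
rewrite /cofactor; congr (_ * \det _); apply/matrixP => a b; rewrite !mxE.
case: splitP => // l eq_al; rewrite !mxE !nth_rcons size_map sB.
(* Row [a] of the minor comes from a row other than the deleted last one. *)
have /negPf-> : l != m :> nat.
  apply/eqP => eq_lm; have /eqP[] := neq_lift (rshift k ord_max) a.
  by apply: val_inj; apply: etrans (esym eq_al); rewrite eq_lm.
by case: ifP.
Qed.

Theorem proposition3p3 (R : realType) (n k m : nat) (lt_km_n : (k + m < n)%N)
    (Z : 'M[R]_(n, k + m)) (rankZ : \rank Z = (k + m)%N)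
    (C : Gr R k n) (Cmx : 'M[R]_(k, n)) (reprC : represents Cmx C)
    (rankCZ : \rank (Cmx *m Z) = k)
    (Y : Gr R k (k + m)) (reprY : represents (Cmx *m Z) Y)
    (Ymx : 'M[R]_(k, k + m)) (reprYmx : represents Ymx Y)
    (A : seq 'I_n) (hA : A \in increasing_lists n (k + m + 1)%:Z)
    (B : seq 'I_n) (hB : B \in increasing_lists n (m%:Z - 1)) :
  \sum_(i <- A) (-1) ^+ (index i A).+1 *
     maximal_minor Z^T [seq j <- A | j != i] * twistor Ymx Z (rcons B i) = 0.
Proof.
case: m lt_km_n Z rankZ rankCZ Y reprY Ymx reprYmx hA hB => [|m] _ Z _ _ _ _ Ymx _.
  (* For [m = 0] the list [B] would have length -1. *)
  by move=> _ /andP[/eqP].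
move=> /andP[/eqP sA A_sorted] /andP[/eqP sB _].
have {}sA : size A = (k + m.+1).+1 by case: sA => ->; rewrite addn1.
have {}sB : size B = m by move: sB; rewrite -addn1 PoszD addrK => -[].
have A_uniq : uniq A.
  by apply: sorted_uniq A_sorted => [j i l|i]; [apply: ltn_trans | apply: ltnn].
have [w twE] := twistor_rcons_linear Ymx Z sB.
case: A sA A_uniq {A_sorted} => // x0 A'; set A := x0 :: A' => sA A_uniq.
pose M := \matrix_(j < (k + m.+1).+1) row (nth x0 A j) Z.
(* Positions in [A] count from 1 but rows of [M] from 0, hence the global minus sign. *)
transitivity (- \sum_c (\sum_(j < (k + m.+1).+1) (-1) ^+ j * \det (row' j M) * M j c) * w c);
  last first.
  by rewrite big1 ?oppr0 // => c _; rewrite cramer_relation mul0r.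
rewrite (big_nth x0) sA big_mkord; rewrite -sumrN.
under [RHS]eq_bigr => c _ do rewrite mulr_suml -sumrN.
rewrite exchange_big; apply: eq_bigr => j _; have ltjA : (j < size A)%N by rewrite sA.
rewrite index_uniq // exprS mulN1r !mulNr twE mulr_sumr -sumrN.
apply: eq_bigr => c _; congr (- _); rewrite mulrA !mxE; congr (_ * _ * _ * _).
(* The minor selects columns of [Z^T], whereas [row' j M] selects rows of [Z]. *)
rewrite /maximal_minor -det_tr; congr (\det _); apply/matrixP => a b; rewrite !mxE.
have sAj : size [seq i <- A | i != nth x0 A j] = (k + m.+1)%N.
  by rewrite -rem_filter // size_rem ?mem_nth // sA.
by rewrite (nth_map x0) ?sAj // nth_filter_neq // mxE.
Qed.
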